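(* Let $X$ be a mixing shift of finite type, $Y$ a mixing sofic shift, and $\pi: X \to Y$ a factor code. For any $\varepsilon > 0$, there exists a mixing shift of finite type $Z \subset X$ with $h(Z) > h(Y) - \varepsilon$ such that $\pi|_Z$ is injective.
   Context: A subshift is a closed, shift-invariant subset of $\mathcal{A}^{\mathbb{Z}}$ for a finite alphabet $\mathcal{A}$ (product topology, shift $(\sigma x)_i = x_{i+1}$). For a subshift $S$, $\mathcal{B}(S)$ is its language (the finite words appearing in points of $S$) and $\mathcal{B}_n(S)$ the words in it of length $n$. A sliding block code is a continuous shift-commuting map between subshifts; a factor code is a surjective sliding block code. A shift of finite type (SFT) is a subshift defined by a finite set of forbidden words; a sofic shift is a factor of an SFT. A subshift $S$ is strongly irreducible with gap $g \geq 1$ if for all $u,w \in \mathcal{B}(S)$ there is $v \in \mathcal{B}_g(S)$ with $uvw \in \mathcal{B}(S)$; ''mixing SFT'' and ''mixing sofic shift'' mean strongly irreducible SFT and strongly irreducible sofic shift. The topological entropy is $h(S) = \lim_{n} \frac1n \log |\mathcal{B}_n(S)|$.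
   Formalization: When h(Y) = 0 (Y a single fixed point or empty), Z is allowed to be empty, with the entropy of the empty shift taken as 0, because a nonempty Z need not exist if X has no fixed point; for h(Y) > 0 the shift Z is nonempty as usual. *)

(* Defs.v *)
From HB Require Import structures.
From mathcomp Require Import all_boot all_order all_algebra.
From mathcomp Require Import all_classical all_reals all_analysis.

Set Implicit Arguments.
Unset Strict Implicit.
Unset Printing Implicit Defensive.

Import Order.TTheory GRing.Theory Num.Theory.
Import numFieldNormedType.Exports.

Local Open Scope classical_set_scope.
Local Open Scope ring_scope.

(* Bi-infinite sequences over A, with the product of the discrete topologies. *)
Notation fullshift A := {ptws int -> discrete_topology A}.

Definition shift (A : finType) (x : fullshift A) : fullshift A :=
  fun i => x (i + 1).

Definition subshift (A : finType) (S : set (fullshift A)) : Prop :=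
  closed S /\ (@shift A) @` S = S.

(* The word x_i x_(i+1) ... x_(i+n-1). *)
Definition window (A : finType) (x : fullshift A) (i : int) (n : nat) : seq A :=
  mkseq (fun k : nat => (x (i + k%:Z) : A)) n.

Definition occurs (A : finType) (w : seq A) (x : fullshift A) : Prop :=
  exists i : int, window x i (size w) = w.

Definition language (A : finType) (S : set (fullshift A)) : set (seq A) :=
  [set w | exists2 x, S x & occurs w x].

Definition num_words (A : finType) (S : set (fullshift A)) (n : nat) : nat :=
  #|[pred w : n.-tuple A | `[< language S (tval w) >]]|.

(* The limit exists for every subshift: by subadditivity if S is nonempty, and
   because ln 0 = 0 if S is empty, so that the empty subshift has entropy 0. *)
Definition entropy (R : realType) (A : finType) (S : set (fullshift A)) : R :=
  lim ((ln (num_words S n)%:R / n%:R : R) @[n --> \oo]).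

Definition strongly_irreducible (A : finType) (S : set (fullshift A))
    (g : nat) : Prop :=
  (0 < g)%N /\
  forall u w : seq A, language S u -> language S w ->
    exists v : seq A, [/\ size v = g, language S v & language S (u ++ v ++ w)].

Definition shift_of_finite_type (A : finType) (S : set (fullshift A)) : Prop :=
  subshift S /\
  exists F : seq (seq A), S = [set x | forall w, w \in F -> ~ occurs w x].

(* Codes are total functions of which only the values on X matter. *)
Definition sliding_block_code (A B : finType) (X : set (fullshift A))
    (Y : set (fullshift B)) (f : fullshift A -> fullshift B) : Prop :=
  [/\ set_fun X Y f,
      {within X, continuous f} &
      forall x, X x -> f (shift x) = shift (f x)].

Definition factor_code (A B : finType) (X : set (fullshift A))
    (Y : set (fullshift B)) (f : fullshift A -> fullshift B) : Prop :=
  sliding_block_code X Y f /\ set_surj X Y f.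

Definition sofic_shift (A : finType) (S : set (fullshift A)) : Prop :=
  subshift S /\
  exists (C : finType) (W : set (fullshift C)) (f : fullshift C -> fullshift A),
    shift_of_finite_type W /\ factor_code W S f.

Definition mixing_sft (A : finType) (S : set (fullshift A)) : Prop :=
  shift_of_finite_type S /\ exists g : nat, strongly_irreducible S g.

Definition mixing_sofic (A : finType) (S : set (fullshift A)) : Prop :=
  sofic_shift S /\ exists g : nat, strongly_irreducible S g.

(* Main.v *)
Require Import Defs.
From HB Require Import structures.
From mathcomp Require Import all_boot all_order all_algebra.
From mathcomp Require Import all_classical all_reals all_analysis.
From mathcomp Require Import zify lra.

Set Implicit Arguments.
Unset Strict Implicit.
Unset Printing Implicit Defensive.

Import Order.TTheory GRing.Theory Num.Theory.
Import numFieldNormedType.Exports.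

Local Open Scope classical_set_scope.
Local Open Scope ring_scope.

(** If Y has entropy zero the empty subshift will do, so let h(Y) > 0.  By
    compactness pi is a block code of some radius r, and X, having finite type,
    can be spliced along a long enough word p: loops at p, that is, words
    running from one occurrence of p to the next, concatenate freely inside X,
    and by mixing every word of X sits inside a loop whose length exceeds that
    of the word by a constant.

    Z consists of the concatenations of blocks

        e e ... e j d_1 j d_2 j ... d_R j

    where e, j and the d_k are loops at p.  Call a break of a point y a position
    at which y fails to have period q = |e|.  The loop j is chosen to force a
    break in the image, which is possible because a shift all of whose points
    have period q has entropy zero.  Each d_k contains a preimage of an
    arbitrary word of length K of Y.  The image of a block thus starts with a
    run free of breaks, and this run is longer than any gap between consecutive
    breaks in the rest of the block.  Hence the block boundaries can be read off
    the image of a point, locally (marks_cuts), and so can the words of Y coded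
    by each block: pi is injective on Z, and Z has finite type because its
    defining conditions are local (coded_shift_sft).  One extra block, longer
    than the others by one letter, makes Z mixing (coded_shift_irreducible).

    A block of length E + R (c + K), with c independent of K and E independent of
    R, carries N^R choices where N >= exp (K h(Y)) is the number of words of
    length K of Y.  So h(Z) is at least R K h(Y) / (E + R (c + K)), which tends
    to h(Y) when first R and then K grow.  Both the lower bound on N and the
    existence of the limit that defines h(Z) come from subadditivity
    (fekete). *)

(** * Windows and the product topology *)

Section Windows.
Context {A : finType}.
Implicit Types (x z : fullshift A) (u v w : seq A) (i d a b : int).

(** Most comparisons below are between a stretch of one point and a shifted
    stretch of another; indexing them by intervals of integers instead of words
    leaves only linear arithmetic on the bounds. *)
Definition agree x z d a b := forall s : int, a <= s < b -> x s = z (s + d).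

Definition reads x i w := window x i (size w) = w.

Lemma window_agree x z i i' n :
  window x i n = window z i' n <-> agree x z (i' - i) i (i + n%:Z).
Proof.
split=> [e s /andP[h1 h2]|e].
- have hk : (`|s - i|%N < n)%N by lia.
  have := congr1 (nth (x s : A) ^~ `|s - i|%N) e.
  rewrite /window !nth_mkseq //.
  have -> : i + `|s - i|%N = s by lia.
  by have -> : i' + `|s - i|%N = s + (i' - i) by lia.
- apply/eq_in_map => k; rewrite mem_iota => /andP[_ hk].
  have -> := e (i + k%:Z); last by lia.
  by congr (z _); lia.
Qed.

Lemma agreeW x z d a b a' b' : a <= a' -> b' <= b ->
  agree x z d a b -> agree x z d a' b'.
Proof. by move=> h1 h2 h s hs; apply: h; lia. Qed.

Lemma agree_sym x z d a b : agree x z d a b -> agree z x (- d) (a + d) (b + d).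
Proof. by move=> h s hs; rewrite h; [congr (z _); lia|lia]. Qed.

Lemma size_window x i n : size (window x i n) = n.
Proof. by rewrite size_mkseq. Qed.

Lemma reads_window x i n : reads x i (window x i n).
Proof. by rewrite /reads size_window. Qed.

Lemma reads_agree x z i i' w :
  reads x i w -> reads z i' w -> agree x z (i' - i) i (i + (size w)%:Z).
Proof. by move=> h1 h2; apply/window_agree; rewrite h1 h2. Qed.

Lemma agree_reads x z i d w : agree x z d i (i + (size w)%:Z) ->
  reads z (i + d) w -> reads x i w.
Proof.
move=> h hz; rewrite /reads -[RHS]hz; apply/window_agree.
by rewrite addrAC subrr add0r.
Qed.

Lemma window_cat x i m n :
  window x i (m + n) = window x i m ++ window x (i + m%:Z) n.
Proof.
rewrite /window /mkseq iotaD map_cat add0n; congr (_ ++ _).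
rewrite -{1}(addn0 m) iotaDl -map_comp; apply: eq_map => k /=.
by congr (x _); lia.
Qed.

Lemma reads_cat x i u v :
  reads x i (u ++ v) <-> reads x i u /\ reads x (i + (size u)%:Z) v.
Proof.
rewrite /reads size_cat window_cat; split=> [/eqP|[-> ->]//].
by rewrite eqseq_cat ?size_window // => /andP[/eqP -> /eqP ->].
Qed.

Lemma language_window (S : set (fullshift A)) x i n : S x -> language S (window x i n).
Proof. by exists x => //; exists i; rewrite size_window. Qed.

Lemma nbhs_agree x a b : nbhs x [set z | agree z x 0 a b].
Proof.
have hc (s : int) : \forall z \near x, (z : fullshift A) s = x s.
  have /(_ [set x s]) := @proj_continuous int (fun=> discrete_topology A) s x.
  by apply; rewrite nbhs_principalE.
have [|h] := boolP (b <= a).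
  move=> h; apply: filterE => z s; lia.
have [n ->] : exists n : nat, b = a + n%:Z by exists `|b - a|%N; lia.
elim: n => [|n IHn]; first by apply: filterE => z s; lia.
near=> z => s hs; rewrite addr0.
have [->|ne] := eqVneq s (a + n%:Z); first by near: z; exact: hc.
have : agree z x 0 a (a + n%:Z) by near: z.
by move=> ->; [rewrite addr0|lia].
Unshelve. all: by end_near.
Qed.

(** Cylinders form a base of neighbourhoods: if no cylinder around x were inside
    U, points chosen in ever longer cylinders outside U would converge to x. *)
Lemma nbhs_agree_sub x (U : set (fullshift A)) : nbhs x U ->
  exists n : nat, [set z | agree z x 0 (- n%:Z) n%:Z] `<=` U.
Proof.
move=> nU; apply: contrapT => /forallNP hn.
have {}hn n : exists z : fullshift A, agree z x 0 (- n%:Z) n%:Z /\ ~ U z.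
  by have /existsNP[z /not_implyP[? ?]] := hn n; exists z.
have [f hf] := choice hn.
have : (f n : fullshift A) @[n --> \oo] --> x.
  apply/cvg_sup => t V [W] [[Q] oQ <-] Wx WV.
  apply: (filterS WV); exists (`|t|%N).+1 => // n /= hn'.
  suff e : f n t = x t by move: Wx; rewrite /= e.
  by rewrite (hf n).1 ?addr0 //; lia.
move=> /(_ _ nU)[N _ /(_ N (leqnn N))].
by have [_] := hf N.
Qed.

End Windows.

(** * Shifts of finite type and block codes *)

Section Shifts.
Context {A : finType}.
Implicit Types (x z : fullshift A) (S : set (fullshift A)).

Definition translate (d : int) x : fullshift A := fun i => x (i + d).

Lemma translate0 x : translate 0 x = x.
Proof. by apply/funext => i; rewrite /translate addr0. Qed.

Lemma agree_translate d x a b : agree (translate d x) x d a b.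
Proof. by []. Qed.

Lemma occurs_agree x z (d : int) w i : agree x z d i (i + (size w)%:Z) ->
  window x i (size w) = w -> occurs w z.
Proof.
move=> h <-; exists (i + d); rewrite size_window; apply/esym/window_agree.
by rewrite addrAC subrr add0r.
Qed.

(** Having finite type, expressed by windows of a fixed length instead of
    forbidden words: a point all of whose windows of length n occur in S lies
    in S.  Splicing arguments use it in this form. *)
Definition finite_step S (n : nat) := forall x,
  (forall i : int, exists2 z, S z & exists d, agree x z d i (i + n%:Z)) -> S x.

Lemma sft_finite_step S : shift_of_finite_type S ->
  exists M : nat, finite_step S M.
Proof.
move=> [_ [F ->]].
exists (\max_(w <- F) size w)%N => x h w wF [i hi].
have [z Sz [d hd]] := h i.
apply: (Sz w wF); apply: (@occurs_agree x z d w i) => //.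
apply: agreeW hd => //.
by rewrite lerD2l lez_nat; apply: (leq_bigmax_seq _ wF).
Qed.

Lemma subshift_translate S x d : subshift S -> S x -> S (translate d x).
Proof.
move=> [_ hS] Sx.
have h1 z : S z -> S (translate 1 z).
  by move=> Sz; rewrite -hS; exists z.
have h2 z : S z -> S (translate (-1) z).
  rewrite -{1}hS => -[z' Sz' <-].
  suff -> : translate (-1) (Defs.shift z') = z' by [].
  by apply/funext => i; rewrite /translate /Defs.shift; congr (z' _); lia.
have nn (n : nat) (e : int) z : (forall z, S z -> S (translate e z)) -> S z ->
    S (translate (n%:Z * e) z).
  move=> he Sz; elim: n => [|n /he].
    suff -> : translate (0%:Z * e) z = z by [].
    by apply/funext => i; rewrite /translate; congr (z _); lia.
  suff -> : translate e (translate (n%:Z * e) z) = translate (n.+1%:Z * e) z by [].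
  by apply/funext => i; rewrite /translate; congr (z _); lia.
have [d0|d0] := boolP (0 <= d).
  by have := nn `|d|%N _ _ h1 Sx; rewrite (_ : `|d|%N%:Z * 1 = d) //; lia.
by have := nn `|d|%N _ _ h2 Sx; rewrite (_ : `|d|%N%:Z * -1 = d) //; lia.
Qed.

(** The forbidden words are the words of length n outside the language of S. *)
Lemma finite_step_sft S n : finite_step S n -> shift_of_finite_type S.
Proof.
move=> h.
have tr d x : S x -> S (translate d x).
  by move=> Sx; apply: h => i; exists x => //; exists d; exact: agree_translate.
split.
  split.
    move=> x clx; apply: h => i.
    have [z [Sz hz]] := clx _ (nbhs_agree x i (i + n%:Z)).
    exists z => //; exists 0.
    by have := agree_sym hz; rewrite !addr0 oppr0.
  apply/seteqP; split=> [_ [x Sx <-]|x Sx]; first exact: (tr 1).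
  exists (translate (-1) x); first exact: tr.
  by apply/funext => i; rewrite /translate /Defs.shift; congr (x _); lia.
exists [seq tval w | w <- enum {: n.-tuple A} & ~~ `[< language S (tval w) >]].
apply/seteqP; split=> [x Sx w /mapP[t + ->] oc|x /= hx].
  rewrite mem_filter => /andP[/asboolPn hn _]; apply: hn.
  by exists x.
apply: h => i.
set w := window x i n.
have sw : size w == n by rewrite size_window.
have : language S w.
  apply: contrapT => hn; apply: (hx w).
    apply/mapP; exists (Tuple sw) => //.
    by rewrite mem_filter mem_enum andbT; apply/asboolPn.
  by exists i; rewrite /w size_window.
move=> [z Sz [j hj]]; exists z => //; exists (j - i).
by apply/window_agree; rewrite -[LHS]hj size_window.
Qed.

End Shifts.

Section BlockMaps.
Context {A B : finType}.
Implicit Types (X : set (fullshift A)) (Y : set (fullshift B)).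

Definition has_radius X (f : fullshift A -> fullshift B) (r : nat) :=
  forall x x' (s d : int), X x -> X x' ->
    agree x x' d (s - r%:Z) (s + r%:Z + 1) -> f x s = f x' (s + d).

Lemma code_translate X Y f d x : subshift X -> sliding_block_code X Y f ->
  X x -> f (translate d x) = translate d (f x).
Proof.
move=> sX [_ _ comm] Xx.
have pos (n : nat) z : X z -> f (translate n%:Z z) = translate n%:Z (f z).
  move=> Xz; elim: n => [|n IHn]; first by rewrite !translate0.
  have -> : translate n.+1%:Z z = Defs.shift (translate n%:Z z).
    by apply/funext => i; rewrite /translate /Defs.shift; congr (z _); lia.
  rewrite comm; last exact: subshift_translate.
  by rewrite IHn; apply/funext => i; rewrite /translate /Defs.shift; congr (f z _); lia.
have [d0|d0] := boolP (0 <= d).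
  by rewrite (_ : d = `|d|%N%:Z); [exact: pos|lia].
have Xdx := subshift_translate d sX Xx.
have := pos `|d|%N _ Xdx.
have -> : translate `|d|%N (translate d x) = x.
  by apply/funext => i; rewrite /translate; congr (x _); lia.
move=> ->.
by apply/funext => i; rewrite /translate; congr (f _ _); lia.
Qed.

(** The theorem of Curtis, Hedlund and Lyndon.  By continuity the letter at 0 of
    the image depends, near each point of X, on finitely many letters; X being
    compact, one radius serves for all points, and commutation with the shift
    carries it to the other positions. *)
Lemma block_code_radius X Y f : subshift X -> sliding_block_code X Y f ->
  exists r, has_radius X f r.
Proof.
move=> sX cf; have [_ ctf comm] := cf.
have cX : compact X.
  apply: (@subclosed_compact _ X setT); [exact: sX.1| |by []].
  have := @tychonoff int (fun=> discrete_topology A) (fun=> setT).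
  have -> : [set g : int -> discrete_topology A | forall i, setT (g i)] = setT.
    by apply/seteqP; split.
  apply=> i; apply: finite_compact.
  exact: (@finite_finset A setT).
pose P (n : nat) x := X x -> forall x', X x' -> agree x' x 0 (- n%:Z) n%:Z -> f x' 0 = f x 0.
have : \forall n \near \oo, X `<=` P n.
  have /compact_near_coveringP := cX.
  apply=> x Xx.
  have : \forall x' \near x, X x' -> f x' 0 = f x 0.
    have cx : f @ within X (nbhs x) --> f x.
      by rewrite nbhs_simpl //= nbhs_subspace_in //=; exact: ctf.
    have h0 := @proj_continuous int (fun=> discrete_topology B) 0 (f x).
    have : nbhs (f x 0) [set f x 0] by rewrite nbhs_principalE.
    by move=> /h0 /cx.
  move=> /nbhs_agree_sub[n hn].
  have nx := nbhs_agree x (- n%:Z) n%:Z.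
  exists ([set z | agree z x 0 (- n%:Z) n%:Z], [set m | (n <= m)%N]) => /=.
    by split => //; exists n.
  move=> [z m] /= [az nm] Xz x' Xx' ax'.
  rewrite (hn z az Xz); apply: hn => // s hs.
  by rewrite ax' ?addr0 ?az ?addr0 //; lia.
move=> [n _ /(_ n (leqnn n)) hn]; exists n => x x' s d Xx Xx' ag.
have e1 := code_translate s sX cf Xx.
have e2 := code_translate (s + d) sX cf Xx'.
have Xt := subshift_translate s sX Xx.
have Xt' := subshift_translate (s + d) sX Xx'.
have := hn _ Xt' Xt' _ Xt.
rewrite e1 e2 /translate !add0r; apply.
move=> t ht; rewrite /translate addr0 ag; last by lia.
by congr (x' _); lia.
Qed.

End BlockMaps.

(** * Counting words *)

(** The limit is the infimum of a n / n.  If a m / m is close to the infimum,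
    dividing n by m gives a n <= n * (a m / m) + C, where C bounds the values of
    a at the remainders, and C / n vanishes in the limit. *)
Lemma fekete (R : realType) (a : nat -> R) :
  (forall n, 0 <= a n) -> (forall m n, a (m + n)%N <= a m + a n) ->
  exists l, (a n / n%:R) @[n --> \oo] --> l /\
    forall n, (0 < n)%N -> l <= a n / n%:R.
Proof.
move=> a0 aD.
set E := [set a n / n%:R | n in [set n | (0 < n)%N]].
have Enn x : E x -> 0 <= x by move=> [n _ <-]; rewrite divr_ge0.
have hasE : has_inf E by split; [exists (a 1%N / 1%:R), 1%N|exists 0].
exists (inf E); split; last first.
  by move=> n n0; apply: (ge_inf hasE.2); exists n.
have lb n : (0 < n)%N -> inf E <= a n / n%:R.
  by move=> n0; apply: (ge_inf hasE.2); exists n.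
apply/cvgrPdist_lt => e e0.
have e20 : 0 < e / 2 by rewrite divr_gt0.
have [_ [m m0 <-] hm] := inf_adherent e20 hasE.
have aM k r : a (k * m + r)%N <= k%:R * a m + a r.
  elim: k => [|k IHk]; first by rewrite mul0n mul0r add0r.
  rewrite mulSn -addnA (le_trans (aD _ _)) // -natr1 mulrDl mul1r.
  by rewrite (addrC _ (a m)) -addrA lerD2l.
pose C := \sum_(r < m) a r.
have hC r : (r < m)%N -> a r <= C.
  move=> rm; rewrite /C (bigD1 (Ordinal rm)) //= lerDl.
  by apply: sumr_ge0 => i _.
have bnd n : a n <= n%:R * (a m / m%:R) + C.
  rewrite {1}(divn_eq n m) (le_trans (aM _ _)) // lerD ?hC ?ltn_mod //.
  rewrite [leRHS]mulrCA (mulrC _ (a m)) ler_wpM2l // ler_pdivlMr ?ltr0n //.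
  by rewrite -natrM ler_nat leq_trunc_div.
near=> n.
have n0 : (0 < n)%N by near: n; exists 1%N.
have n0R : 0 < n%:R :> R by rewrite ltr0n.
rewrite distrC ger0_norm ?subr_ge0 ?lb // ltrBlDl.
rewrite ltr_pdivrMr //.
apply: (le_lt_trans (bnd n)).
have : C < n%:R * (e / 2).
  rewrite -ltr_pdivrMr //.
  near: n.
  exact: nbhs_infty_gtr.
move: hm; rewrite -(ltr_pM2l n0R) => hm hC'.
lra.
Unshelve. all: by end_near.
Qed.

Section Counting.
Context {A : finType}.
Implicit Types (S : set (fullshift A)).

Definition words S n : seq (seq A) :=
  [seq tval w | w <- enum [pred w : n.-tuple A | `[< language S (tval w) >]]].

Lemma size_words S n : size (words S n) = num_words S n.
Proof. by rewrite size_map -cardE. Qed.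

Lemma words_uniq S n : uniq (words S n).
Proof. by rewrite (map_inj_uniq val_inj) enum_uniq. Qed.

Lemma mem_words S n w : (w \in words S n) <-> size w = n /\ language S w.
Proof.
split=> [/mapP[t + ->]|[/eqP sw lw]].
  by rewrite mem_enum => /asboolP lt; rewrite size_tuple.
apply/mapP; exists (Tuple sw) => //.
by rewrite mem_enum; apply/asboolP.
Qed.

Lemma num_words_ge S n (s : seq (seq A)) : uniq s ->
  (forall w, w \in s -> size w = n /\ language S w) -> (size s <= num_words S n)%N.
Proof.
move=> us hs; rewrite -size_words; apply: uniq_leq_size => // w ws.
by apply/mem_words; exact: hs.
Qed.

Lemma language_cat S u v : language S (u ++ v) -> language S u /\ language S v.
Proof.
move=> [x Sx [i /reads_cat[hu hv]]].
by split; exists x => //; [exists i|exists (i + (size u)%:Z)].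
Qed.

Lemma num_words_submul S m n : (num_words S (m + n) <= num_words S m * num_words S n)%N.
Proof.
rewrite -!size_words -(size_allpairs cat).
apply: uniq_leq_size (words_uniq _ _) _ => w /mem_words[sw].
rewrite -(cat_take_drop m w) => /language_cat[h1 h2].
apply: allpairs_f; apply/mem_words; split => //.
  by rewrite size_takel // sw leq_addr.
by rewrite size_drop sw addKn.
Qed.

Context (R : realType).

(** Since ln 0 = 0, the logarithm of the number of words is subadditive even when
    S is empty. *)
Lemma entropy_fekete S :
  ln (num_words S n)%:R / n%:R @[n --> \oo] --> entropy R S /\
  forall n, (0 < n)%N -> entropy R S <= ln (num_words S n)%:R / n%:R.
Proof.
have lnn (k : nat) : 0 <= ln k%:R :> R.
  by case: k => [|k]; [rewrite ln0|rewrite ln_ge0 // ler1n].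
have [l [cl hl]] : exists l, ln (num_words S n)%:R / n%:R @[n --> \oo] --> l /\
    forall n, (0 < n)%N -> l <= ln (num_words S n)%:R / n%:R :> R.
  apply: (fekete (a := fun n => ln (num_words S n)%:R)) => // m n.
  have [->|] := posnP (num_words S (m + n)); first by rewrite ln0 // addr_ge0.
  move=> p0; have := leq_trans p0 (num_words_submul S m n).
  rewrite muln_gt0 => /andP[m0 n0].
  rewrite -lnM ?posrE ?ltr0n // ler_ln ?posrE -?natrM ?ltr0n ?muln_gt0 ?m0 //.
  by rewrite ler_nat num_words_submul.
by rewrite /entropy (cvg_lim _ cl).
Qed.

(** As the limit is known to exist, bounding it along the multiples of L is
    enough. *)
Lemma entropy_ge S (L : nat) (c : R) : (0 < L)%N ->
  (forall k, (0 < k)%N -> c <= ln (num_words S (k * L))%:R / (k * L)%:R) ->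
  c <= entropy R S.
Proof.
move=> L0 h; have [cl _] := entropy_fekete S.
apply/ler_addgt0Pr => e e0.
have /cvgrPdist_lt/(_ e e0)[N _ hN] := cl.
apply: (le_trans (h N.+1 isT)); apply/ltW/ltr_distlDr.
rewrite distrC; apply: hN => /=.
by rewrite (leq_trans (leqnSn N)) // leq_pmulr.
Qed.

Lemma entropy_bounded S (q : nat) :
  (forall n, (q <= n)%N -> (num_words S n <= num_words S q)%N) ->
  entropy R S <= 0.
Proof.
move=> h; have [_ lb] := entropy_fekete S.
rewrite leNgt; apply/negP => h0.
have [C hC] : exists C : R, forall n, (q <= n)%N -> ln (num_words S n)%:R <= C.
  exists (ln (num_words S q).+1%:R) => n qn.
  have [->|p0] := posnP (num_words S n); first by rewrite ln0 // ln_ge0 // ler1n.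
  by rewrite ler_ln ?posrE ?ltr0n // ler_nat (leq_trans (h _ qn)).
pose n := (Num.truncn (C / entropy R S)).+1.
have := lb (n + q)%N (ltn_addr _ (ltn0Sn _)).
rewrite leNgt => /negP; apply.
rewrite ltr_pdivrMr ?ltr0n ?ltn_addr //.
apply: (le_lt_trans (hC _ (leq_addl _ _))).
rewrite mulrC -ltr_pdivrMr //.
apply: (@lt_le_trans _ _ n%:R); last by rewrite ler_nat leq_addr.
by rewrite truncnS_gt.
Qed.

Lemma entropy_set0 : entropy R (set0 : set (fullshift A)) = 0.
Proof.
have e n : num_words (set0 : set (fullshift A)) n = 0%N.
  rewrite -size_words; have := @mem_words set0 n.
  by case: (words _ n) => // w s /(_ w)[/(_ (mem_head _ _))[_ []]].
rewrite /entropy; under eq_fun do rewrite e ln0 // mul0r.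
exact: lim_cst.
Qed.

End Counting.

Section Lists.
Context {T : eqType}.

Fixpoint lists (s : seq T) k : seq (seq T) :=
  if k is k'.+1 then [seq a :: l | a <- s, l <- lists s k'] else [:: [::]].

Lemma size_lists s k : size (lists s k) = (size s ^ k)%N.
Proof. by elim: k => //= k IHk; rewrite size_allpairs IHk expnS. Qed.

Lemma lists_uniq s k : uniq s -> uniq (lists s k).
Proof.
move=> us; elim: k => //= k IHk; apply: allpairs_uniq => //.
by move=> [a l] [b l'] _ _ /= [-> ->].
Qed.

Lemma mem_lists s k l : (l \in lists s k) = (size l == k) && all (mem s) l.
Proof.
elim: k l => [|k IHk] [|a l] //=.
- by apply/negbTE/negP => /allpairsP[[b m] /= [_ _]].
- rewrite eqSS; apply/allpairsP/idP => [[[b m] /= [bs ml [-> ->]]]|/andP[e /andP[h1 h2]]].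
    by move: ml; rewrite IHk bs.
  by exists (a, l); rewrite IHk e.
Qed.

End Lists.

(** * Splicing, loops and points cut into code words *)

Section Splice.
Context {A : finType}.
Implicit Types (x z : fullshift A) (u v w l : seq A).

Definition splice (c d : int) x x' : fullshift A :=
  fun i => if i < c then x i else x' (i + d).

Lemma splice_l c d x x' a : agree (splice c d x x') x 0 a c.
Proof. by move=> s hs; rewrite /splice ifT ?addr0 //; lia. Qed.

Lemma splice_r c d x x' b : agree (splice c d x x') x' d c b.
Proof. by move=> s hs; rewrite /splice ifF //; apply/negbTE; lia. Qed.

End Splice.

Section Loops.
Context {A : finType}.
Implicit Types (x z : fullshift A) (u v w l : seq A).

Context (X : set (fullshift A)) (M : nat).
Hypothesis X_step : finite_step X M.

(** A window of length M that starts before c sees only x, because the points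
    agree on the M positions from c on; any other window sees only x'. *)
Lemma splice_mem c d x x' : X x -> X x' -> agree x x' d c (c + M%:Z) ->
  X (splice c d x x').
Proof.
move=> Xx Xx' ag; apply: X_step => i.
have [ic|ic] := boolP (i < c); last first.
  exists x' => //; exists d; apply: agreeW (@splice_r _ c d x x' _) => //; lia.
exists x => //; exists 0 => s hs; rewrite /splice addr0.
by case: ifP => // sc; rewrite ag //; lia.
Qed.

Context (p : seq A).
Hypothesis Mp : (M <= size p)%N.

(** The occurrence of p that follows the loop is shared with the next one, so it
    does not belong to the loop.  A loop may be shorter than p; the
    empty word, when p is in the language, is a loop. *)
Definition loop l := prefix p (l ++ p) /\ language X (l ++ p).

Lemma loop_nil : language X p -> loop [::].
Proof. by move=> lp; split => //=; exact: prefix_refl. Qed.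

(** The two loops are spliced along the copy of p at which the first one ends and
    the second one starts. *)
Lemma loop_cat l1 l2 : loop l1 -> loop l2 -> loop (l1 ++ l2).
Proof.
move=> [p1 [x1 X1 [i1 r1]]] [/prefixP[t2 p2] [x2 X2 [i2 r2]]].
split.
  have /prefixP[t1 e1] := p1.
  by rewrite -catA p2 catA e1 -catA prefix_prefix.
pose c := i1 + (size l1)%:Z.
have /reads_cat[rl1 rp1] : reads x1 i1 (l1 ++ p) by [].
have /reads_cat[rp2 _] : reads x2 i2 (p ++ t2) by rewrite -p2.
exists (splice c (i2 - c) x1 x2).
  apply: splice_mem => //.
  apply: agreeW (reads_agree rp1 rp2) => //; lia.
exists i1; rewrite -catA; apply/reads_cat; split.
  by apply: (@agree_reads _ _ x1 _ 0); [exact: splice_l|rewrite addr0].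
apply: (@agree_reads _ _ x2 _ (i2 - c)); first exact: splice_r.
by rewrite addrC subrK.
Qed.

Lemma loop_flatten ls : language X p -> (forall l, l \in ls -> loop l) -> loop (flatten ls).
Proof.
move=> lp; elim: ls => [|l ls IH] h; first exact: loop_nil.
apply: loop_cat; first by apply: h; rewrite mem_head.
by apply: IH => l' hl'; apply: h; rewrite inE hl' orbT.
Qed.

Lemma loop_around g u : strongly_irreducible X g -> language X p -> language X u ->
  exists v v', [/\ size v = g, size v' = g & loop (p ++ v ++ u ++ v')].
Proof.
move=> [_ si] lp lu.
have [v [sv _ l1]] := si _ _ lp lu.
have [v' [sv' _ l2]] := si _ _ l1 lp.
exists v, v'; split => //; split; first by rewrite -catA prefix_prefix.
by move: l2; rewrite -!catA.
Qed.

End Loops.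

Section Cuts.
Context {A : finType}.
Implicit Types (x z : fullshift A) (b u v w : seq A).

Context (W : set (seq A)).
Hypothesis W0 : forall b, W b -> (0 < size b)%N.

(** The block starting at c ends at the next element of P.  Forbidding elements
    of P inside the block makes its length a function of P. *)
Definition cut_at x (P : set int) (c : int) b :=
  [/\ W b, reads x c b, P (c + (size b)%:Z) &
      forall k : int, 0 < k < (size b)%:Z -> ~ P (c + k)].

(** A factorization of x into words of W, given by the set P of the starting
    positions of the blocks. *)
Definition cuts x (P : set int) :=
  (forall c, P c -> exists b, cut_at x P c b) /\
  (forall i : int, exists2 c, P c & c <= i).

Lemma cuts_cover x P i : cuts x P ->
  exists c b, [/\ P c, cut_at x P c b & c <= i < c + (size b)%:Z].
Proof.
move=> [fw /(_ i)[c Pc ci]].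
have [n] : exists n : nat, (`|i - c| <= n)%N by exists `|i - c|%N.
elim: n c Pc ci => [|n IHn] c Pc ci hn.
  have [b hb] := fw _ Pc; exists c, b; split => //.
  by have [/W0 ? _ _ _] := hb; lia.
have [b hb] := fw _ Pc; have [/W0 b0 _ Pcb _] := hb.
have [h|h] := boolP (i < c + (size b)%:Z).
  by exists c, b; split => //; lia.
by apply: (IHn _ Pcb); lia.
Qed.

(** No block of x straddles c, since c is itself a cut. *)
Lemma cuts_splice x P x' P' c d : cuts x P -> cuts x' P' -> P c -> P' (c + d) ->
  cuts (splice c d x x') (fun i => if i < c then P i else P' (i + d)).
Proof.
move=> [fw lo] [fw' _] Pc Pcd; split=> [i|i]; last first.
  have [j Pj hj] := lo (Num.min i (c - 1)).
  by exists j; [rewrite ifT //; lia|lia].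
case: ifP => ic Pi.
  have [b [Wb rb Pb nb]] := fw _ Pi; exists b.
  have ibc : i + (size b)%:Z <= c.
    rewrite leNgt; apply/negP => h; apply: (nb (c - i)); first by lia.
    by have -> : i + (c - i) = c by lia.
  split => //.
  - apply: (@agree_reads _ _ x _ 0); last by rewrite addr0.
    exact: agreeW (@splice_l _ c d x x' i).
  - case: ifP => // h; have -> // : i + (size b)%:Z = c by lia.
  - by move=> k hk; rewrite ifT; [exact: nb|lia].
have [b [Wb rb Pb nb]] := fw' _ Pi; exists b; split => //.
- apply: (@agree_reads _ _ x' _ d) => //.
  by apply: agreeW (@splice_r _ c d x x' _) => //; lia.
- rewrite ifF; last by lia.
  by rewrite addrAC.
- move=> k hk; rewrite ifF; last by lia.
  by rewrite addrAC; exact: nb.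
Qed.

Definition periodic (a : A) b : fullshift A :=
  fun i => nth a b `|(i %% (size b)%:Z)%Z|%N.

Lemma reads_periodic a b c : ((size b)%:Z %| c)%Z -> reads (periodic a b) c b.
Proof.
move=> /dvdzP[m ->]; apply: (@eq_from_nth _ a); rewrite size_window // => k hk.
rewrite nth_mkseq // /periodic; congr nth.
by rewrite modzMDl modz_small //; lia.
Qed.

Lemma cuts_periodic a b : W b ->
  cuts (periodic a b) [set i | ((size b)%:Z %| i)%Z].
Proof.
move=> Wb; have b0 := W0 Wb; split=> [c /= dc|i]; last first.
  by exists (- `|i|%N%:Z * (size b)%:Z); [exact: dvdz_mull|nia].
exists b; split => //.
- exact: reads_periodic.
- exact: (rpredD dc (dvdzz _)).
- move=> k hk /= h; have := rpredB h dc; rewrite addrAC subrr add0r.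
  by move=> /dvdz_mod0P; rewrite modz_small; lia.
Qed.

(** Each new block b is taken from the periodic point b b b ..., to which the
    part already built is spliced. *)
Lemma cuts_append x P c bs : cuts x P -> P c -> (forall b, b \in bs -> W b) ->
  exists x2 P2, [/\ cuts x2 P2, (forall s : int, s < c -> x2 s = x s),
    reads x2 c (flatten bs) & P2 (c + (size (flatten bs))%:Z)].
Proof.
elim: bs x P c => [|b bs IH] x P c cx Pc hbs.
  by exists x, P; split => //=; rewrite addr0.
have Wb : W b by apply: hbs; rewrite mem_head.
have [a ba] : exists a, a \in b.
  by have := W0 Wb; case: (b) => // a s _; exists a; rewrite mem_head.
have cp := cuts_periodic a Wb.
have := cuts_splice (d := - c) cx cp Pc; rewrite /= subrr dvdz0 => /(_ isT).
set x1 := splice _ _ _ _; set P1 := (X in cuts _ X) => c1.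
have [|b' bs'|x2 [P2 [cx2 e2 r2 P2c]]] := IH x1 P1 (c + (size b)%:Z) c1.
- by rewrite /P1 ifF; [rewrite addrAC subrr add0r dvdzz|lia].
- by apply: hbs; rewrite inE bs' orbT.
exists x2, P2; split => //.
- move=> s sc; rewrite e2; last by lia.
  by rewrite /x1 /splice sc.
- apply/reads_cat; split => //.
  apply: (@agree_reads _ _ (periodic a b) _ (- c)).
    move=> s /andP[h1 h2]; rewrite e2 //.
    by rewrite /x1 /splice ifF //; lia.
  by rewrite subrr; apply: reads_periodic; rewrite dvdz0.
- by rewrite /= size_cat PoszD addrA.
Qed.

End Cuts.

(** * Subshifts of concatenations *)

Section CodedShift.
Context {A : finType} (W : set (seq A)) (L : nat).
Hypothesis L0 : (0 < L)%N.
Hypothesis W_size : forall b, W b -> size b = L \/ size b = L.+1.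

Definition coded_shift : set (fullshift A) := [set x | exists P, cuts W x P].

Lemma code_word_gt0 b : W b -> (0 < size b)%N.
Proof. by move=> /W_size[] ->. Qed.

Lemma cuts_join x P c x' P' c' bs : cuts W x P -> P c ->
  cuts W x' P' -> P' c' -> (forall b, b \in bs -> W b) ->
  exists2 z, coded_shift z &
    [/\ forall a, agree z x 0 a c, reads z c (flatten bs) &
        forall b, agree z x' (c' - (c + (size (flatten bs))%:Z))
                        (c + (size (flatten bs))%:Z) b].
Proof.
move=> cx Pc cx' Pc' hbs.
have [y [Q [cy ey ry Qy]]] := cuts_append code_word_gt0 cx Pc hbs.
set c1 := c + (size (flatten bs))%:Z in Qy *.
exists (splice c1 (c' - c1) y x').
  eexists; apply: (cuts_splice cy cx' Qy).
  by rewrite addrC subrK.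
split=> [a s /andP[h1 h2]||b].
- by rewrite /splice ifT ?addr0 ?ey // /c1; lia.
- apply: (@agree_reads _ _ y _ 0); last by rewrite addr0.
  exact: splice_l.
- exact: splice_r.
Qed.

Lemma coded_shift_words b bs : W b -> (forall b', b' \in bs -> W b') ->
  language coded_shift (flatten bs).
Proof.
move=> Wb hbs; have := code_word_gt0 Wb; case E: b => [|a s] // _.
have cb := cuts_periodic code_word_gt0 a Wb.
have [x [P [cx _ rx _]]] := cuts_append code_word_gt0 cb (dvdz0 _) hbs.
by exists x; [exists P|exists 0].
Qed.

(** Two words are extended to the nearest cuts, and the remaining gap is filled
    with blocks.  A gap of length f = k * L + r with r < L <= k is the total
    length of k - r blocks of length L and r blocks of length L + 1, so that
    every f >= L * L can be filled. *)
Lemma coded_shift_irreducible b0 b1 : W b0 -> size b0 = L -> W b1 -> size b1 = L.+1 ->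
  exists g, strongly_irreducible coded_shift g.
Proof.
move=> W0 s0 W1 s1.
(* The cuts are at distance at most L + 1 after u and at most L before w. *)
pose g := (L * L + L + L + 1)%N.
exists g; split; first by rewrite /g addn1.
move=> u w [x Sx [i ru]] [x' Sx' [i' rw]].
have [P cx] := Sx; have [P' cx'] := Sx'.
pose e : int := i + (size u)%:Z.
have [c [b [Pc [Wb _ Pcb _] hc]]] := cuts_cover code_word_gt0 e cx.
have [c2 [b2 [Pc2 [Wb2 _ _ _] hc2]]] := cuts_cover code_word_gt0 i' cx'.
pose c1 : int := c + (size b)%:Z.
pose f : nat := absz (g%:Z - (c1 - e) - (i' - c2))%R.
have sb := W_size Wb; have sb2 := W_size Wb2.
have fE : f%:Z = g%:Z - (c1 - e) - (i' - c2) by rewrite /f /c1 /g; lia.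
have fL : (L * L <= f)%N by move: fE; rewrite /c1 /g; lia.
pose k := (f %/ L)%N; pose r := (f %% L)%N.
have rL : (r < L)%N by rewrite ltn_mod.
have kL : (L <= k)%N by rewrite leq_divRL.
have fkr : f = (k * L + r)%N := divn_eq f L.
pose bs := nseq (k - r) b0 ++ nseq r b1.
have hbs b' : b' \in bs -> W b'.
  by rewrite mem_cat !mem_nseq => /orP[] /andP[_ /eqP ->].
have sbs : size (flatten bs) = f.
  rewrite size_flatten /shape map_cat !map_nseq s0 s1 sumn_cat !sumn_nseq.
  have : (L * r <= L * k)%N by rewrite leq_mul2l (leq_trans (ltnW rL) kL) orbT.
  by rewrite [RHS]fkr mulnBr mulSn (mulnC k); lia.
have [z Sz [zl _ zr]] := cuts_join cx Pcb cx' Pc2 hbs.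
rewrite sbs -/c1 in zl zr.
exists (window z e g); split; first exact: size_window.
  exact: language_window.
exists z => //; exists i; apply/reads_cat; split.
  apply: (@agree_reads _ _ x _ 0); last by rewrite addr0.
  by apply: agreeW (zl i) => //; rewrite /c1 /e in hc *; lia.
apply/reads_cat; split; first exact: reads_window.
rewrite size_window.
apply: (@agree_reads _ _ x' _ (c2 - (c1 + f%:Z))).
  apply: agreeW (zr _) => //; rewrite -/e; lia.
suff -> : i + (size u)%:Z + g%:Z + (c2 - (c1 + f%:Z)) = i' by [].
by rewrite -/e; lia.
Qed.

Context (X : set (fullshift A)) (M : nat) (p : seq A).
Hypothesis X_step : finite_step X M.
Hypothesis Mp : (M <= size p)%N.
Hypothesis W_loop : forall b, W b -> loop X p b /\ prefix p b.

(** Every block is followed by a block that starts with p, so every window of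
    length M lies in a word b ++ p with b a block. *)
Lemma cuts_mem x P : cuts W x P -> X x.
Proof.
move=> cx; apply: X_step => i.
have [c [b [Pc [Wb rb Pcb _] hi]]] := cuts_cover code_word_gt0 i cx.
have [b' [Wb' rb' _ _]] := cx.1 _ Pcb.
have [_ /prefixP[t eb']] := W_loop  Wb'.
have [[_ [z Xz [j rz]]] _] := W_loop  Wb.
exists z => //; exists (j - c).
have rbp : reads x c (b ++ p).
  by apply/reads_cat; split=> //; move: rb'; rewrite eb' => /reads_cat[].
by apply: agreeW (reads_agree rbp rz) => //; rewrite ?size_cat; lia.
Qed.

Lemma coded_shift_sub : coded_shift `<=` X.
Proof. by move=> x [P cx]; exact: cuts_mem cx. Qed.

(** marks is a rule that reads the cuts off a point by looking at distance at
    most rho. *)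
Context (marks : fullshift A -> set int) (rho : nat).
Hypothesis marks_cuts : forall x P, cuts W x P -> P = marks x.
Hypothesis marks_local : forall x z (d i : int), X x -> X z ->
  agree x z d (i - rho%:Z) (i + rho%:Z) -> (marks x i <-> marks z (i + d)).

(** Whether the marks of x cut it into words of W is decided by looking at windows of bounded
    length, which by assumption look the same as in points of the coded
    shift. *)
Lemma coded_shift_sft : shift_of_finite_type coded_shift.
Proof.
pose n := (M + rho * 2 + L * 2 + 4)%N.
apply: (@finite_step_sft _ _ n) => x hx.
have Xx : X x.
  apply: X_step => i; have [z Sz [d hz]] := hx i.
  exists z; first exact: coded_shift_sub.
  by exists d; apply: agreeW hz => //; rewrite /n; lia.
exists (marks x); split=> [c mc|i].
  have [z Sz [d hz]] := hx (c - rho%:Z).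
  have Xz := coded_shift_sub Sz.
  have [P cz] := Sz; have eP := marks_cuts cz; subst P.
  have mz j : c <= j <= c + L%:Z + 1 -> marks x j <-> marks z (j + d).
    move=> hj; apply: marks_local => //; apply: agreeW hz => //; rewrite /n; lia.
  have mzc : marks z (c + d) by apply/mz => //; lia.
  have [b [Wb rb Pb nb]] := cz.1 _ mzc.
  have sb := W_size Wb.
  exists b; split => //.
  - by apply: agree_reads rb; apply: agreeW hz; rewrite /n; lia.
  - by apply/mz; [lia|rewrite addrAC].
  - move=> k hk /mz h; apply: (nb k hk); rewrite addrAC; apply: h; lia.
have [z Sz [d hz]] := hx (i - L%:Z - rho%:Z).
have Xz := coded_shift_sub Sz.
have [P cz] := Sz; have eP := marks_cuts cz; subst P.
have [c [b [mc [Wb _ _ _] hc]]] := cuts_cover code_word_gt0 (i + d) cz.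
have sb := W_size Wb.
exists (c - d); last by lia.
apply/(@marks_local _ z d) => //; last by rewrite subrK.
by apply: agreeW hz; rewrite /n; lia.
Qed.

End CodedShift.

(** * Recognizing block boundaries in the image *)

Section Markers.
Context {A B : finType} (X : set (fullshift A)) (f : fullshift A -> fullshift B).
Context (r : nat) (fr : has_radius X f r).

Lemma radius_agree x z d a b : X x -> X z -> agree x z d a b ->
  agree (f x) (f z) d (a + r%:Z) (b - r%:Z).
Proof.
move=> Xx Xz ag s hs; apply: fr => //; apply: agreeW ag; lia.
Qed.

Context (q : nat).

Definition breaks (y : fullshift B) (s : int) := y s <> y (s - q%:Z).

Lemma agree_breaks y y' d a b s : agree y y' d a b -> a + q%:Z <= s < b ->
  breaks y s <-> breaks y' (s + d).
Proof.
by move=> ag hs; rewrite /breaks !ag ?[s - _ + _]addrAC //; lia.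
Qed.

(** A mark is seen delta positions to its right, as the first break after a run
    of at least H positions free of breaks. *)
Definition marks (H delta : nat) (y : fullshift B) : set int :=
  [set i | breaks y (i + delta%:Z) /\
     forall s, i + delta%:Z - H%:Z <= s < i + delta%:Z -> ~ breaks y s].

Lemma marks_local (H delta : nat) x z (d i : int) : X x -> X z ->
  agree x z d (i - (delta + H + q + r + 1)%:Z) (i + (delta + H + q + r + 1)%:Z) ->
  marks H delta (f x) i <-> marks H delta (f z) (i + d).
Proof.
move=> Xx Xz ag; have ag' := radius_agree Xx Xz ag.
have bE s : i + delta%:Z - H%:Z <= s <= i + delta%:Z ->
    breaks (f x) s <-> breaks (f z) (s + d).
  by move=> hs; apply: (agree_breaks ag'); lia.
rewrite /marks /= (_ : i + d + delta%:Z = i + delta%:Z + d); last by lia.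
split=> -[b0 h]; split.
- by apply/bE => //; lia.
- move=> s hs bs; apply: (h (s - d)); first by lia.
  by apply/bE; [lia|rewrite subrK].
- by apply/bE => //; lia.
- by move=> s hs /bE bs; apply: (h (s + d)); [lia|apply: bs; lia].
Qed.

Definition power (e : seq A) T := flatten (nseq T e).

Lemma size_power e T : size (power e T) = (T * size e)%N.
Proof. by rewrite size_flatten /shape map_nseq sumn_nseq mulnC. Qed.

(** Inside a power of e the point has period |e|, hence so does its image. *)
Lemma power_breaks x c e T s : size e = q -> X x -> reads x c (power e T) ->
  c + q%:Z + r%:Z <= s -> s + r%:Z < c + (T * q)%:Z -> ~ breaks (f x) s.
Proof.
case: T => [|T] size_e Xx rx h1 h2; first by lia.
apply; apply: fr => //.
have : reads x (c + q%:Z) (power e T).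
  by move: rx; rewrite /power /= => /reads_cat[_]; rewrite size_e.
have : reads x c (power e T).
  move: rx; rewrite /power -addn1 nseqD flatten_cat => /reads_cat[] //.
move=> ra rb; have := reads_agree rb ra; rewrite size_power size_e.
have -> : c - (c + q%:Z) = - q%:Z by lia.
apply: agreeW; lia.
Qed.

(** The margins make the break depend on the copy of j alone: both letters of
    the image that it compares are computed inside that copy. *)
Definition forces_break (j : seq A) := forall x c, X x -> reads x c j ->
  exists s : int,
    [/\ c + q%:Z + r%:Z <= s, s + r%:Z < c + (size j)%:Z & breaks (f x) s].

Context (j : seq A).
Hypothesis j_breaks : forces_break j.

Definition spaced (ds : seq (seq A)) := flatten [seq d ++ j | d <- ds].

(** The last copy of j that is completed before t starts at distance at most 2 * N
    from t, and it forces a break. *)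
Lemma spaced_breaks (N : nat) x c d ds (t : int) : X x -> reads x c (spaced (d :: ds)) ->
  (forall d', d' \in d :: ds -> (size d' + size j <= N)%N) ->
  c + (size d + size j)%:Z <= t <= c + (size (spaced (d :: ds)))%:Z ->
  exists s, t - (2 * N)%:Z <= s < t /\ breaks (f x) s.
Proof.
move=> Xx; elim: ds d c => [|d' ds IH] d c rx hN ht.
all: have hd := hN d (mem_head _ _).
all: move: (rx); rewrite /spaced /= -/(spaced _) => /reads_cat[/reads_cat[_ rj] rx'].
all: have [s [s1 s2 s3]] := j_breaks Xx rj.
  by exists s; split => //; move: ht; rewrite /spaced /= cats0 size_cat; lia.
have hd' : (size d' + size j <= N)%N by apply: hN; rewrite !inE eqxx orbT.
have [tl|tl] := boolP (t < c + (size d + size j)%:Z + (size d' + size j)%:Z).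
  by exists s; split => //; lia.
apply: (IH d' _ rx').
  by move=> d1 h; apply: hN; rewrite inE h orbT.
move: ht; rewrite /spaced /= -/(spaced _) !size_cat; lia.
Qed.

Context (e : seq A) (T N : nat).
Hypotheses (size_e : size e = q) (Nj : (size j <= N)%N).
(** H exceeds the distance between consecutive breaks away from the power of e
    (at most 2 * N, and q + r more where the next block begins), while the
    power of e leaves room for a run of H positions free of breaks. *)
Let E := (T * q)%N.
Let H := (3 * N + q + r)%N.
Hypothesis HE : (H + q + 2 * r <= E)%N.

Definition block ds := power e T ++ spaced ([::] :: ds).

(** A block starts with a power of e followed by j.  The first break that they
    force is at the same distance delta from the start of every block, because
    everything up to that break is computed inside these two words. *)
Lemma first_break : language X (power e T ++ j) -> exists delta : nat,
  [/\ (E <= delta + r)%N, (q + r <= delta)%N &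
   forall x c, X x -> reads x c (power e T ++ j) ->
    breaks (f x) (c + delta%:Z) /\
    forall s, c + (q + r)%:Z <= s < c + delta%:Z -> ~ breaks (f x) s].
Proof.
move=> [x0 X0 [c0 r0]].
pose Q := [pred n | (q + r <= n)%N & `[< breaks (f x0) (c0 + n%:Z) >]].
have := r0 => /reads_cat[rp0 rj0].
have [s [s1 s2 s3]] := j_breaks X0 rj0.
have sE : c0 + `|s - c0|%N = s by move: s1; rewrite size_power size_e; lia.
have exQ : exists n, Q n.
  exists `|s - c0|%N; rewrite /= sE; apply/andP; split; last exact/asboolP.
  by move: s1; rewrite size_power size_e; lia.
case: (ex_minnP exQ) => n /andP[qn /asboolP bn] minn.
have nE : (E <= n + r)%N.
  rewrite leqNgt; apply/negP => h.
  by apply: (power_breaks (s := c0 + n%:Z) size_e X0 rp0) bn; rewrite -/E; lia.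
have ns : (n <= `|s - c0|)%N.
  apply: minn; rewrite /= sE; apply/andP; split; last exact/asboolP.
  by move: s1; rewrite size_power size_e; lia.
exists n; split => // x c Xx rx.
have ag := radius_agree Xx X0 (reads_agree rx r0).
have bE m : (q + r <= m <= n)%N -> breaks (f x) (c + m%:Z) <-> breaks (f x0) (c0 + m%:Z).
  move=> hm; rewrite (agree_breaks ag).
    by have -> : c + m%:Z + (c0 - c) = c0 + m%:Z by lia.
  by move: s2; rewrite size_cat size_power size_e; lia.
split; first by apply/bE => //; rewrite qn leqnn.
move=> t ht.
have -> : t = c + `|t - c|%N%:Z by lia.
move/bE => bt.
have : (n <= `|t - c|)%N.
  by apply: minn; apply/andP; split; [lia|apply/asboolP/bt; lia].
lia.
Qed.

Context (delta : nat).
Hypotheses (dE : (E <= delta + r)%N) (dq : (q + r <= delta)%N).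
Hypothesis dP : forall x c, X x -> reads x c (power e T ++ j) ->
    breaks (f x) (c + delta%:Z) /\
    forall s, c + (q + r)%:Z <= s < c + delta%:Z -> ~ breaks (f x) s.

Context (W : set (seq A)).
Hypothesis W_block : forall b, W b ->
  exists2 ds, b = block ds & forall d, d \in ds -> (size d + size j <= N)%N.
Hypothesis WX : forall x P, cuts W x P -> X x.

(** The break at distance delta from the start of a block ends a run of H
    positions free of breaks, inside the power of e.  Every other break follows
    an earlier one at distance at most H: up to the end of a block, and for
    q + r positions beyond it, by spaced_breaks; and the next break after those
    positions is already the one at distance delta in the next block. *)
Lemma marks_cuts x P : q != 0%N -> cuts W x P -> P = marks H delta (f x).
Proof.
move=> q0 cx; have Xx := WX cx.
have W0 b : W b -> (0 < size b)%N.
  by move=> /W_block[ds -> _]; rewrite size_cat size_power size_e -/E; lia.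
have start c : P c -> reads x c (power e T ++ j).
  move=> /cx.1[b [/W_block[ds -> _] + _ _]].
  by rewrite /block /spaced /= catA => /reads_cat[].
apply/seteqP; split=> [c Pc|i [bi nbi]].
  have [b1 b2] := dP Xx (start _ Pc).
  by split => // s hs; apply: b2; lia.
have [c [b [Pc [Wb rb Pcb _] hc]]] := cuts_cover W0 i cx.
have [b1 b2] := dP Xx (start _ Pc).
have [b1' b2'] := dP Xx (start _ Pcb).
have [ic|ic] := eqVneq i c; first by rewrite ic.
exfalso.
have h1 : c + delta%:Z < i + delta%:Z - H%:Z.
  by rewrite ltNge; apply/negP => h; apply: (nbi (c + delta%:Z)) => //; lia.
have h2 : i + delta%:Z < c + (size b)%:Z + (q + r)%:Z.
  by rewrite ltNge; apply/negP => h; apply: (b2' (i + delta%:Z)) => //; lia.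
have [ds bE dsN] := W_block Wb.
move: rb; rewrite bE => /reads_cat[_ rs].
have sb : size b = (E + size (spaced ([::] :: ds)))%N.
  by rewrite bE size_cat size_power size_e.
have sj : (size j <= size (spaced ([::] :: ds)))%N.
  by rewrite /spaced /= size_cat leq_addr.
have [||s [s1 s2]] := @spaced_breaks N _ _ _ _
  (Num.min (i + delta%:Z) (c + (size b)%:Z)) Xx rs.
- by move=> d'; rewrite inE => /predU1P[->|/dsN].
- by rewrite size_power size_e /=; lia.
apply: (nbi s) => //; lia.
Qed.

End Markers.

(** * The code *)

Section Code.
Context {A B : finType} (X : set (fullshift A)) (Y : set (fullshift B)).
Context (f : fullshift A -> fullshift B) (M : nat) (p : seq A) (r : nat).
Hypothesis X_step : finite_step X M.
Hypotheses (Mp : (M <= size p)%N) (lp : language X p) (fr : has_radius X f r).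
(** enc codes a word u of Y by a loop that contains a preimage of u; u appears in
    the image o positions after the start of the loop. *)
Context (e j : seq A) (enc : seq B -> seq A) (c0 o : nat).
Let q := size e.
Hypotheses (e0 : (0 < size e)%N) (e_loop : loop X p e) (pe : prefix p e).
Hypotheses (j_loop : loop X p j) (j_breaks : forces_break X f r q j).
Hypotheses (enc_loop : forall u, language Y u -> loop X p (enc u))
  (enc_size : forall u, language Y u -> size (enc u) = (c0 + size u)%N)
  (enc_decode : forall u x c, language Y u -> X x -> reads x c (enc u) ->
     reads (f x) (c + o%:Z) u).

Definition coding us := spaced j [seq enc u | u <- us].

Lemma size_coding K us : (forall u, u \in us -> u \in words Y K) ->
  size (coding us) = (size us * (c0 + K + size j))%N.
Proof.
elim: us => [//|u us IH] h.
have /mem_words[su lu] := h u (mem_head _ _).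
rewrite /coding /spaced /= !size_cat -[flatten _]/(coding us) IH.
  by rewrite enc_size // su mulSn.
by move=> v hv; apply: h; rewrite inE hv orbT.
Qed.

(** Both factorizations have the same shape, so the coded words stand at the same
    places of the common image. *)
Lemma coding_decode K us us' x x' c : X x -> X x' -> f x = f x' ->
  (forall u, u \in us -> u \in words Y K) -> (forall u, u \in us' -> u \in words Y K) ->
  size us = size us' ->
  reads x c (coding us) -> reads x' c (coding us') -> us = us'.
Proof.
move=> Xx Xx' ff; elim: us us' c => [|u us IH] [|u' us'] c // h h' /= [ss].
have /mem_words[su lu] := h u (mem_head _ _).
have /mem_words[su' lu'] := h' u' (mem_head _ _).
move=> /reads_cat[/reads_cat[ru _] rus] /reads_cat[/reads_cat[ru' _] rus'].
have := enc_decode lu Xx ru; have := enc_decode lu' Xx' ru'.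
rewrite /reads su su' ff => -> <-; congr (_ :: _).
apply: (IH us' _ _ _ ss rus).
- by move=> v hv; apply: h; rewrite inE hv orbT.
- by move=> v hv; apply: h'; rewrite inE hv orbT.
- by move: rus'; rewrite !size_cat !enc_size // su su'.
Qed.

(** N bounds the length of a coded word followed by j, also in the long block,
    and T is large enough for the power of e to outlast the gaps between breaks
    elsewhere. *)
Context (K R' : nat) (y0 : fullshift B) (Yy0 : Y y0).
Let R := R'.+1.
Let N := (c0 + K + 1 + size j)%N.
Let T := (3 * N + 3 * r + 2)%N.
Let E1 := (T * q + size j)%N.
Let L := (E1 + R * (c0 + K + size j))%N.
Let blk := block j e T.

(** The first of its coded words has length K + 1 instead of K, which makes it one
    letter longer than the other blocks. *)
Definition long_block :=
  blk [seq enc u | u <- window y0 0 K.+1 :: nseq R' (window y0 0 K)].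

Definition payload_block us := blk [seq enc u | u <- us].

Definition payload us := size us = R /\ forall u, u \in us -> u \in words Y K.

Definition code : set (seq A) :=
  [set b | (exists2 us, payload us & b = payload_block us) \/ b = long_block].

Lemma window_words n : window y0 0 n \in words Y n.
Proof. by apply/mem_words; split; [exact: size_window|exact: language_window]. Qed.

Lemma blk_size ds : size (blk ds) = (E1 + size (spaced j ds))%N.
Proof. by rewrite /blk /block size_cat size_power /spaced /= size_cat /E1 addnA. Qed.

Lemma payload_size us : payload us -> size (payload_block us) = L.
Proof. by move=> [su h]; rewrite blk_size (size_coding h) su. Qed.

Lemma nseq_words n u : u \in nseq n (window y0 0 K) -> u \in words Y K.
Proof. by rewrite mem_nseq => /andP[_ /eqP ->]; exact: window_words. Qed.

Lemma long_size : size long_block = L.+1.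
Proof.
rewrite blk_size /spaced /= size_cat -[flatten _]/(coding (nseq R' _)).
rewrite (@size_coding K) ?size_nseq; last exact: nseq_words.
have /mem_words[s1 l1] := window_words K.+1.
by rewrite size_cat enc_size // s1 /L /R; lia.
Qed.

Lemma code_form b : code b -> exists2 us, b = blk [seq enc u | u <- us] &
  forall u, u \in us -> language Y u /\ (size u <= K.+1)%N.
Proof.
move=> [[us [_ h] ->]|->].
  exists us => // u /h/mem_words[-> lu]; split => //; exact: leqnSn.
eexists; first by [].
move=> u; rewrite inE => /predU1P[->|/nseq_words/mem_words[-> //]].
by have /mem_words[-> l1] := window_words K.+1.
Qed.

Lemma code_loop b : code b -> loop X p b /\ prefix p b.
Proof.
move=> /code_form[us -> h].
have T0 : T = T.-1.+1 by rewrite /T addn2.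
split; last first.
  have /prefixP[t et] := pe.
  by rewrite /blk /block T0 /power /= et -!catA prefix_prefix.
apply: (loop_cat X_step Mp).
  by apply: (loop_flatten X_step Mp) => // l; rewrite mem_nseq => /andP[_ /eqP ->].
apply: (loop_flatten X_step Mp) => // l.
rewrite /= inE => /predU1P[->//|/mapP[d /mapP[u hu ->] ->]].
by apply: (loop_cat X_step Mp) => //; apply: enc_loop; exact: (h _ hu).1.
Qed.

Lemma code_block b : code b -> exists2 ds, b = block j e T ds &
  forall d, d \in ds -> (size d + size j <= N)%N.
Proof.
move=> /code_form[us -> h]; eexists; first by [].
by move=> d /mapP[u /h[lu su] ->]; rewrite enc_size // /N leq_add2r -addnA leq_add2l addn1.
Qed.

Lemma code_size b : code b -> size b = L \/ size b = L.+1.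
Proof. by move=> [[us du ->]|->]; [left; exact: payload_size|right; exact: long_size]. Qed.

Lemma L_gt0 : (0 < L)%N.
Proof. rewrite /L /E1 /T; nia. Qed.

Let Z := coded_shift code.

Lemma payload_nseq : payload (nseq R (window y0 0 K)).
Proof. by split; [exact: size_nseq|exact: nseq_words]. Qed.

Lemma code_payload us : payload us -> code (payload_block us).
Proof. by move=> h; left; exists us. Qed.

Lemma marksP : exists mk : fullshift B -> set int, exists rho : nat,
  (forall x P, cuts code x P -> P = mk (f x)) /\
  forall x z (d i : int), X x -> X z ->
    agree x z d (i - rho%:Z) (i + rho%:Z) -> (mk (f x) i <-> mk (f z) (i + d)).
Proof.
have Nj : (size j <= N)%N by rewrite leq_addl.
have HE : (3 * N + q + r + q + 2 * r <= T * q)%N by rewrite /T; have : (0 < q)%N := e0; nia.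
have le : language X (power e T ++ j).
  have [_] := (code_loop (code_payload payload_nseq)).1.
  by rewrite /payload_block /blk /block /spaced /= catA -!catA catA => /language_cat[].
have [delta [d1 d2 d3]] := first_break fr j_breaks (erefl : size e = q) Nj HE le.
pose H := (3 * N + q + r)%N.
exists (marks q H delta), (delta + H + q + r + 1)%N; split; last first.
  by move=> x z d i Xx Xz ag; exact: (marks_local fr Xx Xz ag).
move=> x P.
apply: (marks_cuts j_breaks _ Nj HE d1 d2 d3) => //.
- exact: code_block.
- by move=> x' P' cx; apply: (coded_shift_sub L_gt0 code_size X_step Mp code_loop); exists P'.
- by rewrite -lt0n.
Qed.

Lemma code_mixing_sft : mixing_sft Z.
Proof.
have [mk [rho [h1 h2]]] := marksP.
split; first exact: (coded_shift_sft L_gt0 code_size X_step Mp code_loop h1 h2).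
have cl : code long_block by right.
exact: (coded_shift_irreducible L_gt0 code_size (code_payload payload_nseq)
  (payload_size payload_nseq) cl long_size).
Qed.

Lemma code_sub : Z `<=` X.
Proof. exact: (coded_shift_sub L_gt0 code_size X_step Mp code_loop). Qed.

(** The image determines the cuts, the cuts determine the length of each block,
    and a block of length L is determined by the words that it codes, while
    there is only one block of length L + 1. *)
Lemma code_inj : set_inj Z f.
Proof.
have [mk [rho [h1 h2]]] := marksP.
move=> x x' /set_mem Zx /set_mem Zx' ff.
have Xx := code_sub Zx; have Xx' := code_sub Zx'.
have [P cx] := Zx; have [P' cx'] := Zx'.
have eP : P' = P by rewrite (h1 _ _ cx) (h1 _ _ cx') ff.
subst P'; apply/funext => i.
have W0 := code_word_gt0 L_gt0 code_size.
have [c [b [Pc [Wb rb Pb nb] hi]]] := cuts_cover W0 i cx.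
have [b' [Wb' rb' Pb' nb']] := cx'.1 _ Pc.
have sb : size b = size b'.
  have b0 := W0 _ Wb; have b0' := W0 _ Wb'.
  have [h|h|] := ltngtP (size b) (size b') => //.
    have hk : 0 < (size b)%:Z < (size b')%:Z by lia.
    by case: (nb' _ hk).
  have hk : 0 < (size b')%:Z < (size b)%:Z by lia.
  by case: (nb _ hk).
have bb : b = b'.
  case: Wb Wb' sb rb rb' => [[us du ->]|->] [[us' du' ->]|->] //.
  - move=> _; rewrite /payload_block /blk /block.
    move=> /reads_cat[_ /reads_cat[_ r1]] /reads_cat[_ /reads_cat[_ r2]].
    by rewrite (coding_decode Xx Xx' ff du.2 du'.2 _ r1 r2) // du.1 du'.1.
  - by rewrite payload_size // long_size => /n_Sn.
  - by rewrite payload_size // long_size => /esym/n_Sn.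
rewrite -bb in rb'; have ag := reads_agree rb rb'.
by rewrite ag ?subrr ?addr0.
Qed.

Lemma code_nonempty : Z !=set0.
Proof.
have [|x Zx _] := @coded_shift_words _ _ _ L_gt0 code_size _ [::] (code_payload payload_nseq).
  by [].
by exists x.
Qed.

(** Distinct lists of words of Y give distinct blocks, by coding_decode applied to
    a single point, and distinct lists of blocks of length L give distinct
    concatenations. *)
Lemma code_num_words k : ((num_words Y K ^ R) ^ k <= num_words Z (k * L))%N.
Proof.
pose D := [seq payload_block us | us <- lists (words Y K) R].
have payloadP us : us \in lists (words Y K) R -> payload us.
  by rewrite mem_lists => /andP[/eqP su /allP h].
have uD : uniq D.
  rewrite map_inj_in_uniq ?lists_uniq ?words_uniq // => us us' /payloadP[su h] /payloadP[su' h'].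
  rewrite /payload_block /blk /block => /eqP; rewrite eqseq_cat // => /andP[_].
  rewrite /spaced /= eqseq_cat // => /andP[_ /eqP ee].
  have [_ [x Xx [c rx]]] := (code_loop (code_payload (conj su h))).1.
  move: rx; rewrite /payload_block /blk /block /spaced /= -!catA.
  move=> /reads_cat[_ /reads_cat[_ /reads_cat[rx _]]].
  by apply: (coding_decode Xx Xx erefl h h' _ rx); rewrite ?su ?su' // /coding /spaced -ee.
have sD : size D = (num_words Y K ^ R)%N by rewrite size_map size_lists size_words.
have DP b : b \in D -> code b /\ size b = L.
  by move=> /mapP[us /payloadP du ->]; split; [exact: code_payload|exact: payload_size].
have shapeE bs : {in bs, forall b, b \in D} -> shape bs = nseq (size bs) L.
  elim: bs => //= b bs IH h; congr (_ :: _).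
    by have [] := DP b (h _ (mem_head _ _)).
  by apply: IH => b' hb'; apply: h; rewrite inE hb' orbT.
rewrite -sD -size_lists -(size_map flatten).
apply: num_words_ge.
  rewrite map_inj_in_uniq ?lists_uniq // => bs bs'.
  rewrite !mem_lists => /andP[/eqP s1 /allP a1] /andP[/eqP s2 /allP a2] ee.
  by apply: eq_from_flatten_shape => //; rewrite (shapeE _ a1) (shapeE _ a2) s1 s2.
move=> w /mapP[bs + ->]; rewrite mem_lists => /andP[/eqP <- /allP hbs]; split.
  by rewrite size_flatten (shapeE _ hbs) sumn_nseq mulnC.
by apply: (coded_shift_words L_gt0 code_size (code_payload payload_nseq)) => b /hbs /DP[].
Qed.

Lemma code_subshift : exists Z', [/\ mixing_sft Z', Z' `<=` X, set_inj Z' f,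
  Z' !=set0 & forall k, ((num_words Y K ^ R) ^ k <= num_words Z' (k * L))%N].
Proof.
exists Z; split; [exact: code_mixing_sft|exact: code_sub|exact: code_inj|
  exact: code_nonempty|exact: code_num_words].
Qed.

End Code.

(** * Choice of the parameters *)

(** Otherwise a word of Y would be determined by its first q letters, and the
    number of words would be bounded. *)
Lemma exists_break (R : realType) (B : finType) (Y : set (fullshift B)) (q : nat) :
  (0 < q)%N -> 0 < entropy R Y -> exists2 y, Y y & exists s, breaks q y s.
Proof.
move=> q0 h0; apply: contrapT => hn.
have per y s : Y y -> y s = y (s - q%:Z).
  by move=> Yy; apply: contrapT => b; apply: hn; exists y => //; exists s.
suff : entropy R Y <= 0 by lra.
apply: (@entropy_bounded _ _ _ q) => n qn.
rewrite -!size_words -(size_map (take q)); apply: uniq_leq_size.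
  rewrite map_inj_in_uniq ?words_uniq // => u v /mem_words[su [y Yy [i ru]]].
  move=> /mem_words[sv [y' Yy' [i' rv]]]; rewrite -ru -rv su sv => tt.
  have per' k : y (i + k%:Z) = y' (i' + k%:Z).
    have [m] := ubnP k; elim: m k => // m IH k km.
    have [kq|kq] := ltnP k q.
      have := congr1 (nth (y i : B) ^~ k) tt.
      by rewrite !nth_take // !nth_mkseq ?(leq_trans kq).
    rewrite per // [RHS]per //.
    have := IH (k - q)%N; have -> : (k - q)%N%:Z = k%:Z - q%:Z by lia.
    by rewrite !addrA; apply; lia.
  by apply/window_agree => s hs; have := per' `|s - i|%N; congr (y _ = y' _); lia.
move=> w /mapP[u /mem_words[su lu] ->]; apply/mem_words.
rewrite size_takel ?su //; split => //.
by move: lu; rewrite -{1}(cat_take_drop q u) => /language_cat[].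
Qed.

(** The order of the quantifiers is what makes the entropy estimate work: the
    overhead c of a coded word does not depend on its length K, and the length E
    of the marker does not depend on the number of words that follow it. *)
Lemma injective_subshifts (A B : finType) (X : set (fullshift A))
    (Y : set (fullshift B)) (f : fullshift A -> fullshift B) :
  mixing_sft X -> factor_code X Y f ->
  (forall q, (0 < q)%N -> exists2 y, Y y & exists s, breaks q y s) ->
  exists c : nat, forall K : nat, exists E : nat, forall R' : nat, exists Z,
    [/\ mixing_sft Z, Z `<=` X, set_inj Z f, Z !=set0 &
      forall k, ((num_words Y K ^ R'.+1) ^ k <=
                 num_words Z (k * (E + R'.+1 * (c + K))))%N].
Proof.
move=> [sX [g siX]] [cf surj] Yb.
have [M X_step] := sft_finite_step sX.
have [r fr] := block_code_radius sX.1 cf.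
have lift y : Y y -> exists2 x, X x & f x = y by move=> /surj.
have [y0 Yy0 _] := Yb 1%N isT.
have [x0 Xx0 _] := lift _ Yy0.
pose p := window x0 0 M.
have sp : size p = M := size_window _ _ _.
have lp : language X p by exact: language_window.
have l0 : language X [::] by exact: (language_window 0 0 Xx0).
have [v [v' [sv sv' e_loop]]] := loop_around siX lp l0.
pose e := p ++ v ++ [::] ++ v'.
have g0 : (0 < g)%N := siX.1.
have e0 : (0 < size e)%N by rewrite /e !size_cat sv sv' /=; lia.
have pe : prefix p e by exact: prefix_prefix.
pose q := size e.
have [y1 Yy1 [s1 b1]] := Yb q e0.
have [x1 Xx1 fx1] := lift _ Yy1.
(* A preimage of the letters at s1 - q, ..., s1. *)
pose bt := window x1 (s1 - q%:Z - r%:Z) (q + 2 * r + 1).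
have [w [w' [sw sw' j_loop]]] := loop_around siX lp (language_window _ _ Xx1 : language X bt).
pose j := p ++ w ++ bt ++ w'.
have j_breaks : forces_break X f r q j.
  move=> x c Xx /reads_cat[_ /reads_cat[_ /reads_cat[rb _]]].
  move: rb; rewrite -addrA -PoszD sp sw => rb.
  have ag := radius_agree fr Xx Xx1 (reads_agree rb (reads_window _ _ _)).
  exists (c + (M + g)%:Z + q%:Z + r%:Z).
  rewrite /j !size_cat sp sw sw' size_window; split; [lia|lia|].
  apply/(agree_breaks ag); first by rewrite size_window; lia.
  by rewrite fx1 (_ : _ + (_ - _) = s1) //; lia.
have lifts u : exists d, language Y u ->
    [/\ loop X p d, size d = (M + g + 2 * r + g + size u)%N &
     forall x c, X x -> reads x c d -> reads (f x) (c + (M + g + r)%:Z) u].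
  have [lu|nlu] := pselect (language Y u); last by exists [::].
  have [y Yy [i ru]] := lu; have [x Xx fx] := lift _ Yy.
  pose ut := window x (i - r%:Z) (size u + 2 * r).
  have [z [z' [sz sz' d_loop]]] := loop_around siX lp (language_window _ _ Xx : language X ut).
  exists (p ++ z ++ ut ++ z') => _; split => //.
    by rewrite !size_cat sp sz sz' size_window; lia.
  move=> x' c Xx' /reads_cat[_ /reads_cat[_ /reads_cat[rb _]]].
  move: rb; rewrite -addrA -PoszD sp sz => rb.
  have ag := radius_agree fr Xx' Xx (reads_agree rb (reads_window _ _ _)).
  apply: (agree_reads (z := f x)).
    by apply: agreeW ag; rewrite ?size_window; lia.
  by rewrite fx (_ : _ + (_ - _) = i) //; lia.
have [enc hdw] := choice lifts.
exists (M + g + 2 * r + g + size j)%N => K.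
eexists => R'.
have dl u lu := let: And3 a _ _ := hdw u lu in a.
have ds u lu := let: And3 _ b _ := hdw u lu in b.
have dd u x c lu := let: And3 _ _ h := hdw u lu in h x c.
have Mp : (M <= size p)%N by rewrite sp.
have [Z [mZ ZX iZ nZ cZ]] := code_subshift X_step Mp lp fr e0 e_loop pe j_loop
  j_breaks dl ds dd K R' Yy0.
exists Z; split => // k; apply: leq_trans (cZ k) _.
by rewrite [(_ + size j + K)%N]addnAC.
Qed.

Theorem corollary1p4 (R : realType) (A B : finType)
    (X : set (fullshift A)) (Y : set (fullshift B))
    (pi : fullshift A -> fullshift B) (eps : R) :
  mixing_sft X -> mixing_sofic Y -> factor_code X Y pi -> 0 < eps ->
  exists Z : set (fullshift A),
    [/\ mixing_sft Z,
        Z `<=` X,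
        entropy R Y - eps < entropy R Z,
        set_inj Z pi &
        0 < entropy R Y -> Z !=set0].
Proof.
move=> mX _ fc eps0.
have [hY|hY] := leP (entropy R Y) 0.
  exists set0; split => //.
  - split; last first.
      by exists 1%N; split => // u w [].
    split; last first.
      exists [:: [::]]; apply/seteqP; split=> // x /(_ [::] (mem_head _ _)).
      by apply; exists 0.
    split; first exact: closed0.
    by rewrite image_set0.
  - by rewrite entropy_set0; lra.
  - by move=> x y; rewrite in_set0.
have [c hc] := injective_subshifts mX fc (fun q q0 => exists_break q0 hY).
set h := entropy R Y in hY *.
have [_ hle] := entropy_fekete R Y.
(* K makes the overhead of the coded words cost less than eps / 2, and R' does
   the same for the overhead of the marker. *)
pose K := (Num.truncn (h * c%:R / (eps / 2))).+1.
have hK : h * c%:R < (eps / 2) * K%:R.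
  by rewrite [ltRHS]mulrC -ltr_pdivrMr ?divr_gt0 // /K truncnS_gt.
have [E hE] := hc K.
pose R' := Num.truncn (h * E%:R / (eps / 2)).
have hR : h * E%:R < (eps / 2) * R'.+1%:R.
  by rewrite [ltRHS]mulrC -ltr_pdivrMr ?divr_gt0 // truncnS_gt.
have [Z [mZ ZX iZ nZ cZ]] := hE R'.
exists Z; split => //.
set n := num_words Y K in cZ.
set L := (E + R'.+1 * (c + K))%N in cZ.
have K0 : 0 < K%:R :> R by rewrite ltr0n.
have lnn : h * K%:R <= ln n%:R.
  by have := hle K isT; rewrite ler_pdivlMr.
have L0 : (0 < L)%N by rewrite /L /K; lia.
have L0R : 0 < L%:R :> R by rewrite ltr0n.
have n0 : (0 < n)%N.
  rewrite lt0n; apply/negP => /eqP n0; move: lnn; rewrite n0 ln0 //.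
  by rewrite leNgt mulr_gt0.
apply: (@lt_le_trans _ _ (R'.+1%:R * ln n%:R / L%:R)); last first.
  apply: (entropy_ge L0) => k k0.
  have kL0 : 0 < (k * L)%:R :> R by rewrite ltr0n muln_gt0 k0.
  rewrite ler_pdivrMr // mulrAC ler_pdivlMr //.
  have lnE : ln ((n ^ R'.+1) ^ k)%:R = k%:R * (R'.+1%:R * ln n%:R) :> R.
    rewrite -expnM (natrX _ n) lnXn ?ltr0n // -(mulr_natl (ln _)).
    by rewrite natrM mulrAC mulrC mulrA.
  have : ln ((n ^ R'.+1) ^ k)%:R <= ln (num_words Z (k * L))%:R :> R.
    rewrite ler_ln ?posrE ?ltr0n ?expn_gt0 ?n0 //; first by rewrite ler_nat.
    by rewrite (leq_trans _ (cZ k)) // !expn_gt0 n0.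
  rewrite lnE => le1; rewrite natrM mulrA ler_pM2r //.
  by rewrite mulrC.
rewrite ltr_pdivlMr //.
apply: (@lt_le_trans _ _ (R'.+1%:R * (h * K%:R))); last by rewrite ler_pM2l ?ltr0n.
have LE : L%:R = E%:R + R'.+1%:R * (c%:R + K%:R) :> R by rewrite /L natrD natrM natrD.
have R0 : 1 <= R'.+1%:R :> R by rewrite ler1n.
have K1 : 1 <= K%:R :> R by rewrite ler1n.
rewrite LE; set a := R'.+1%:R in hR R0 *; set kk := K%:R in hK K1 *.
have h1 : a * (h * c%:R) < a * (eps / 2 * kk) by rewrite ltr_pM2l //; lra.
have h2 : eps / 2 * a <= eps / 2 * a * kk by rewrite ler_peMr // ?mulr_ge0 //; lra.
have h3 : 0 <= eps * (E%:R + a * c%:R) by rewrite mulr_ge0 ?addr_ge0 ?mulr_ge0 //; lra.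
lra.
Qed.
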